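(* Let $t\ge 1$ and $s\ge 1$ be integers. Then $\chi_p(P_{2t}\Diamond_2 C_{4s+2})\le 4$ if $1\le t\le 2$, and $\chi_p(P_{2t}\Diamond_2 C_{4s+2})\le 5$ if $t\ge 3$. Moreover, equality holds for $t\in\{1,2\}$.
   Context: A packing $k$-coloring of a graph $H$ is a map $c:V(H)\to\{1,\ldots,k\}$ such that any two distinct vertices $u,v$ with $c(u)=c(v)=i$ satisfy $d_H(u,v)\ge i+1$. The packing chromatic number $\chi_p(H)$ is the least such $k$. $P_m$ denotes the path $v_1\cdots v_m$ and $C_n$ the cycle on $n$ vertices. Path-aligned product: for positive integers $\ell\mid m$ and a connected vertex-transitive graph $G$ containing $P_\ell$ as a subgraph, $P_m\Diamond_\ell G$ is formed from the path $P_m=v_1\cdots v_m$ and $m/\ell$ pairwise disjoint copies of $G$, where for each $1\le i\le m/\ell$ the consecutive path vertices $v_{(i-1)\ell+1},\ldots,v_{i\ell}$ are identified, in order, with the vertices of a path $P_\ell$ (i.e. $\ell$ consecutive cycle vertices when $G$ is a cycle) in the $i$-th copy of $G$. *)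

(* Defs.v *)
(* A graph on a finite vertex type is given by its adjacency
   relation, symmetric and irreflexive for a simple graph. *)
From mathcomp Require Import all_boot.

Set Implicit Arguments.
Unset Strict Implicit.
Unset Printing Implicit Defensive.

Section Distance.

Variables (T : finType) (e : rel T).

Definition walk_of_length (u v : T) (n : nat) : bool :=
  [exists p : n.-tuple T, path e u p && (last u p == v)].

(* A shortest walk repeats no vertex, so its length is below #|T|. When no walk
   joins u to v this returns the junk value #|T|; see [distP]. *)
Definition dist (u v : T) : nat :=
  find (walk_of_length u v) (iota 0 #|T|).

Lemma walk_of_lengthP (u v : T) (n : nat) :
  reflect (exists p, [/\ path e u p, last u p = v & size p = n])
          (walk_of_length u v n).
Proof.
apply: (iffP existsP) => [[p /andP[pp /eqP lp]]|[p [pp lp sp]]].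
  by exists (val p); rewrite size_tuple.
by move/eqP: sp => sp; exists (Tuple sp); rewrite /= pp lp eqxx.
Qed.

Lemma distP (u v : T) : connect e u v ->
  walk_of_length u v (dist u v) /\
  forall n, walk_of_length u v n -> dist u v <= n.
Proof.
move=> /connectP[p0 pp0 ->].
case/shortenP: pp0 => p pp up _.
have ltp : size p < #|T| by rewrite -[(size p).+1]/(size (u :: p)) -(card_uniqP up) max_card.
have hs : has (walk_of_length u (last u p)) (iota 0 #|T|).
  apply/hasP; exists (size p); first by rewrite mem_iota.
  by apply/walk_of_lengthP; exists p.
have ltd : dist u (last u p) < #|T| by move: (hs); rewrite has_find size_iota.
split=> [|n wn]; first by have := nth_find 0 hs; rewrite nth_iota.
rewrite leqNgt; apply/negP => ltn.
have := before_find 0 ltn; rewrite nth_iota ?(ltn_trans ltn) //.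
by rewrite add0n wn.
Qed.

End Distance.

Section PackingColoring.

Variables (T : finType) (e : rel T).

(* The value c u : 'I_k stands for the color (c u).+1 in {1, ..., k}. Vertices
   in different components are at infinite distance and are not constrained. *)
Definition packing_coloring (k : nat) (c : {ffun T -> 'I_k}) : bool :=
  [forall u, forall v, [&& u != v, c u == c v & connect e u v] ==>
     ((c u).+1 + 1 <= dist e u v)].

Definition packing_colorable (k : nat) : bool :=
  [exists c : {ffun T -> 'I_k}, packing_coloring c].

Lemma packing_colorable_card : exists k, packing_colorable k.
Proof.
exists #|T|; apply/existsP; exists [ffun u => enum_rank u].
apply/forallP => u; apply/forallP => v; apply/implyP => /and3P[nuv].
by rewrite !ffunE (inj_eq enum_rank_inj) (negPf nuv).
Qed.

Definition packing_chromatic : nat := ex_minn packing_colorable_card.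

End PackingColoring.

(* This is the n-cycle for n >= 3. *)
Definition cycle_graph (n : nat) : rel 'I_n :=
  [rel u v | (v == ordS u) || (u == ordS v)].

Definition is_path_in (T : finType) (e : rel T) (l : nat) (p : l.-tuple T) :
  bool := uniq p && sorted e p.

Section PathAlignedProduct.

(* [a i] lists the vertices of the path P_l chosen in the i-th copy of G. *)
Variables (T : finType) (e : rel T) (m l : nat).
Variable a : 'I_(m %/ l) -> l.-tuple T.

(* As every vertex of P_m is identified with a vertex of a copy of G, the
   vertex set is the disjoint union of the m / l copies. Indices start at 0:
   vertex k of P_m is entry k %% l of the path in copy k %/ l. *)
Definition path_vertex (k : nat) (u : 'I_(m %/ l) * T) : bool :=
  (u.1 == k %/ l :> nat) && (onth (a u.1) (k %% l) == Some u.2).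

Definition path_edge (u v : 'I_(m %/ l) * T) : bool :=
  [exists k : 'I_m, [&& k.+1 < m, path_vertex k u & path_vertex k.+1 v]].

Definition path_aligned_product : rel ('I_(m %/ l) * T) :=
  [rel u v | [|| (u.1 == v.1) && e u.2 v.2, path_edge u v | path_edge v u]].

End PathAlignedProduct.

(* Main.v *)
(** Number each cycle from its attaching vertices, which get positions 0 and 1.
    With n = 4 s + 2, colour 1 sits on the even positions, and the odd positions
    other than n - 1 alternate between 2 and 3, starting with 2 in the copies of
    even index and with 3 in the others; position n - 1 gets 4 in the former and
    5 in the latter. For at most two copies the colour 5 is avoided by giving
    the first copy the pattern 1 3 2 1 4 2 (1 3 1 2)^(s-1) and the second one
    the even pattern.

    With three colours, a window of four consecutive cycle vertices is so
    constrained that 1 occurs on every other vertex and 2, 3 alternate in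
    between; this has period 4, which does not divide n. *)
Require Import Defs.
From mathcomp Require Import all_boot.
From mathcomp Require Import zify.

Set Implicit Arguments.
Unset Strict Implicit.
Unset Printing Implicit Defensive.

Section DistanceBounds.

Variables (T : finType) (e : rel T).

Lemma dist_ge_lipschitz (f : T -> nat) (u v : T) :
  (forall x y, e x y -> f y <= (f x).+1) -> f u = 0 -> connect e u v ->
  f v <= dist e u v.
Proof.
move=> lip fu /distP[/walk_of_lengthP[p [pp <- <-]] _].
have {fu} : f u <= 0 by rewrite fu.
rewrite -[size p]add0n; elim: p u 0 pp => [|x p IH] u k /=; first by rewrite addn0.
by case/andP=> /lip eux /IH{}IH fu; rewrite addnS -addSn IH // (leq_trans eux).
Qed.

Lemma walk_of_length_iter (w : nat -> T) (j d : nat) :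
  (forall k, e (w k) (w k.+1)) -> walk_of_length e (w j) (w (j + d)) d.
Proof.
move=> ew; apply/walk_of_lengthP; exists [seq w k | k <- iota j.+1 d].
rewrite size_map size_iota.
by elim: d j => [|d IH] j; [rewrite addn0|case: (IH j.+1) => /= -> -> _; rewrite ew addSnnS].
Qed.

Lemma dist_iter_le (w : nat -> T) (j d : nat) :
  (forall k, e (w k) (w k.+1)) ->
  connect e (w j) (w (j + d)) /\ dist e (w j) (w (j + d)) <= d.
Proof.
move=> ew; have wd := walk_of_length_iter j d ew.
have cw : connect e (w j) (w (j + d)).
  by case/walk_of_lengthP: wd => p [pp lp _]; apply/connectP; exists p.
by split=> //; case: (distP cw) => _; apply.
Qed.

Lemma packing_chromatic_le (k : nat) :
  packing_colorable e k -> packing_chromatic e <= k.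
Proof. by rewrite /packing_chromatic; case: ex_minnP => m _; apply. Qed.

Lemma packing_chromatic_colorable : packing_colorable e (packing_chromatic e).
Proof. by rewrite /packing_chromatic; case: ex_minnP. Qed.

Lemma packing_colorable_nat (k : nat) (c : T -> nat) (D : T -> T -> nat) :
  (forall u, c u < k) -> (forall u, D u u = 0) ->
  (forall u x y, e x y -> D u y <= (D u x).+1) ->
  (forall u v, u != v -> c u = c v -> c u + 2 <= D u v) ->
  packing_colorable e k.
Proof.
move=> ck D0 Dlip Dc; apply/existsP; exists [ffun u => Ordinal (ck u)].
apply/forallP => u; apply/forallP => v; apply/implyP => /and3P[nuv].
rewrite !ffunE -val_eqE /= => /eqP cuv uv.
apply: leq_trans (dist_ge_lipschitz (Dlip u) (D0 u) uv).
by rewrite addSnnS Dc.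
Qed.

End DistanceBounds.

Lemma ordS_val (n : nat) (u : 'I_n) :
  ordS u = (if u.+1 == n then 0 else u.+1) :> nat.
Proof.
rewrite /=; case: eqP => [->|ne]; first by rewrite modnn.
by rewrite modn_small //; have := ltn_ord u; lia.
Qed.

Lemma cycle_graphE (n : nat) (u v : 'I_n) :
  @cycle_graph n u v =
  ((v == (if u.+1 == n then 0 else u.+1) :> nat) ||
   (u == (if v.+1 == n then 0 else v.+1) :> nat)).
Proof. by rewrite /cycle_graph /= -!val_eqE -!ordS_val. Qed.

Definition cycle_pos (n : nat) (x y v : 'I_n) : nat :=
  if y == ordS x then (if x <= v then v - x else v + n - x)
  else (if v <= x then x - v else x + n - v).

Definition cyc (n p q : nat) : nat :=
  minn (p - q + (q - p)) (n - (p - q + (q - p))).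

Definition chain_dist (n i p j q : nat) : nat :=
  if i == j then cyc n p q
  else if i < j then cyc n p 1 + cyc n 0 q + (2 * (j - i)).-1
  else cyc n p 0 + cyc n 1 q + (2 * (i - j)).-1.

Lemma cyc_refl (n p : nat) : cyc n p p = 0.
Proof. by rewrite /cyc subnn min0n. Qed.

Lemma cycC (n p q : nat) : cyc n p q = cyc n q p.
Proof. by rewrite /cyc addnC. Qed.

Lemma chain_distC (n i p j q : nat) :
  chain_dist n i p j q = chain_dist n j q i p.
Proof.
rewrite /chain_dist !(cycC n 0) !(cycC n 1) (cycC n p q) eq_sym.
by case: (ltngtP i j) => //= _; rewrite [X in X + _]addnC.
Qed.

Lemma cyc01 (n : nat) : 2 < n -> cyc n 0 1 = 1 /\ cyc n 1 0 = 1.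
Proof. by rewrite /cyc; lia. Qed.

Lemma cyc_triangle (n p q r : nat) : p < n -> q < n -> r < n ->
  cyc n p r <= cyc n p q + cyc n q r.
Proof. by rewrite /cyc; lia. Qed.

Lemma chain_dist_step (n i p j q k r : nat) : 2 < n -> p < n -> q < n -> r < n ->
  [\/ j = k /\ cyc n q r = 1, [/\ k = j.+1, q = 1 & r = 0]
    | [/\ j = k.+1, q = 0 & r = 1]] ->
  chain_dist n i p k r <= (chain_dist n i p j q).+1.
Proof.
move=> n2 pn qn rn; have n1 := ltnW n2; have n0 := ltnW n1.
have C00 := cyc_refl n 0; have C11 := cyc_refl n 1; have [C01 C10] := cyc01 n2.
rewrite /chain_dist; case=> [[<- qr]|[-> -> ->]|[-> -> ->]].
- have := cyc_triangle pn qn rn; have := cyc_triangle n0 qn rn.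
  have := cyc_triangle n1 qn rn; rewrite qr.
  by case: (ltngtP i j) => _; lia.
- have := cyc_triangle pn n1 n0; have := cyc_triangle pn n0 n1.
  by case: (ltngtP i j) => ?; case: (ltngtP i j.+1) => ?; subst; lia.
- have := cyc_triangle pn n1 n0; have := cyc_triangle pn n0 n1.
  by case: (ltngtP i k) => ?; case: (ltngtP i k.+1) => ?; subst; lia.
Qed.

Lemma cycle_pos_lt (n : nat) (x y v : 'I_n) : cycle_pos x y v < n.
Proof.
rewrite /cycle_pos; have := ltn_ord v; have := ltn_ord x.
by do ![case: ifP]; lia.
Qed.

Lemma cycle_pos_inj (n : nat) (x y : 'I_n) : injective (cycle_pos x y).
Proof.
move=> u v; rewrite /cycle_pos => h; apply: val_inj => /=.
move: h; have := ltn_ord v; have := ltn_ord u; have := ltn_ord x.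
by case: (y == _); do ![case: ifP]; lia.
Qed.

Lemma cycle_pos_first (n : nat) (x y : 'I_n) : cycle_pos x y x = 0.
Proof. by rewrite /cycle_pos leqnn subnn if_same. Qed.

Lemma cycle_pos_second (n : nat) (x y : 'I_n) :
  2 < n -> @cycle_graph n x y -> cycle_pos x y y = 1.
Proof.
rewrite /cycle_pos; have -> : (y == ordS x) = (y == (if x.+1 == n then 0 else x.+1) :> nat).
  by rewrite -ordS_val.
rewrite cycle_graphE.
by have := ltn_ord x; have := ltn_ord y; do ![case: ifP]; lia.
Qed.

Lemma cycle_pos_edge (n : nat) (x y u v : 'I_n) : 2 < n -> @cycle_graph n u v ->
  cyc n (cycle_pos x y u) (cycle_pos x y v) = 1.
Proof.
move=> n_gt2; rewrite cycle_graphE /cycle_pos /cyc.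
have := ltn_ord x; have := ltn_ord v; have := ltn_ord u.
by case: (y == _); case: ifP; case: ifP; case: ifP; case: ifP; lia.
Qed.

Lemma divn2_modn2_succ (k : nat) :
  [/\ k.+1 %/ 2 = k %/ 2, k.+1 %% 2 = 1 & k %% 2 = 0] \/
  [/\ k.+1 %/ 2 = (k %/ 2).+1, k.+1 %% 2 = 0 & k %% 2 = 1].
Proof. by have [ok|ok] := boolP (odd k); [right|left]; split; lia. Qed.

Section Chain.

Variables (n t : nat) (a : 'I_((2 * t) %/ 2) -> 2.-tuple 'I_n).
Hypotheses (n_gt2 : 2 < n) (ha : forall i, is_path_in (@cycle_graph n) (a i)).

Definition pos (u : 'I_((2 * t) %/ 2) * 'I_n) : nat :=
  cycle_pos (tnth (a u.1) ord0) (tnth (a u.1) ord_max) u.2.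

Lemma attached_edge i : @cycle_graph n (tnth (a i) ord0) (tnth (a i) ord_max).
Proof.
have x0 : 'I_n := thead (a i).
move: (ha i) => /andP[_]; rewrite !(tnth_nth x0).
by case: (a i) => [[|x [|y []]]] //= _; rewrite andbT.
Qed.

Lemma path_vertex_pos (k : nat) u : path_vertex a k u ->
  u.1 = k %/ 2 :> nat /\ pos u = k %% 2.
Proof.
case/andP=> /eqP -> h; split=> //; rewrite /pos; move: h.
have := cycle_pos_first (tnth (a u.1) ord0) (tnth (a u.1) ord_max).
have := cycle_pos_second n_gt2 (attached_edge u.1).
rewrite !(tnth_nth u.2); case: (a u.1) => [[|x [|y []]]] //= _.
by rewrite modn2; case: (odd k) => /= hy hx /eqP[<-].
Qed.

Lemma product_edge u v : path_aligned_product (@cycle_graph n) a u v ->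
  [\/ u.1 = v.1 :> nat /\ cyc n (pos u) (pos v) = 1,
      [/\ v.1 = u.1.+1 :> nat, pos u = 1 & pos v = 0]
    | [/\ u.1 = v.1.+1 :> nat, pos u = 0 & pos v = 1]].
Proof.
have pe u' v' : path_edge a u' v' ->
    u'.1 = v'.1 :> nat /\ cyc n (pos u') (pos v') = 1 \/
    [/\ v'.1 = u'.1.+1 :> nat, pos u' = 1 & pos v' = 0].
  case/existsP=> k /and3P[_ /path_vertex_pos[-> ->] /path_vertex_pos[-> ->]].
  have [C01 _] := cyc01 n_gt2.
  by case: (divn2_modn2_succ k) => -[-> -> ->]; [left|right].
case/or3P=> [/andP[/eqP eq1 e2]|/pe[]|/pe[[-> h]|[]]].
- apply: Or31; split; first by rewrite eq1.
  by rewrite /pos eq1; apply: cycle_pos_edge.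
- by move=> h; apply: Or31.
- by move=> h; apply: Or32.
- by apply: Or31; rewrite cycC.
- by move=> *; apply: Or33.
Qed.

Lemma pos_lt u : pos u < n. Proof. exact: cycle_pos_lt. Qed.

Lemma pos_neq (u v : 'I_((2 * t) %/ 2) * 'I_n) :
  u != v -> u.1 = v.1 :> nat -> pos u != pos v.
Proof.
case: u v => [i p] [j q] /= + /val_inj ij; rewrite -{}ij => nuv.
by apply: contraNneq nuv => /cycle_pos_inj /= ->.
Qed.

Lemma chain_dist_lipschitz (u v w : 'I_((2 * t) %/ 2) * 'I_n) :
  path_aligned_product (@cycle_graph n) a v w ->
  chain_dist n u.1 (pos u) w.1 (pos w) <=
  (chain_dist n u.1 (pos u) v.1 (pos v)).+1.
Proof.
move=> vw; apply: chain_dist_step; rewrite ?pos_lt //.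
exact: product_edge.
Qed.

Lemma chain_colorable (k : nat) (c : nat -> nat -> nat) :
  (forall i p, c i p < k) ->
  (forall i p j q, i < (2 * t) %/ 2 -> j < (2 * t) %/ 2 -> p < n -> q < n ->
     (i, p) != (j, q) -> i <= j -> c i p = c j q ->
     c i p + 2 <= chain_dist n i p j q) ->
  packing_colorable (path_aligned_product (@cycle_graph n) a) k.
Proof.
move=> ck Dc; pose V : finType := ('I_((2 * t) %/ 2) * 'I_n)%type.
pose D (u v : V) := chain_dist n u.1 (pos u) v.1 (pos v).
apply: (@packing_colorable_nat V _ k (fun u => c u.1 (pos u)) D) => //.
- by move=> u; rewrite /D /chain_dist eqxx cyc_refl.
- by move=> u v w; apply: chain_dist_lipschitz.
move=> u v nuv cuv.
have npq : (val u.1, pos u) != (val v.1, pos v).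
  by apply/eqP=> -[/(pos_neq nuv)/eqP].
have [le|/ltnW le] := leqP u.1 v.1; first by apply: Dc; rewrite ?pos_lt.
by rewrite cuv /D chain_distC; apply: Dc; rewrite ?pos_lt // eq_sym.
Qed.

End Chain.

(* Colours are shifted down by one, as in [packing_coloring]. *)
Definition even_pattern (s p : nat) : nat :=
  if ~~ odd p then 0 else if p == 4 * s + 1 then 3 else if p %% 4 == 1 then 1 else 2.

Definition odd_pattern (s p : nat) : nat :=
  if ~~ odd p then 0 else if p == 4 * s + 1 then 4 else if p %% 4 == 1 then 2 else 1.

Definition first_pattern (p : nat) : nat :=
  if p == 1 then 2 else if p == 2 then 1 else if p == 3 then 0
  else if p == 4 then 3 else if ~~ odd p then 0
  else if p %% 4 == 1 then 1 else 2.

Lemma five_colors (s i p j q : nat) (n := 4 * s + 2)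
    (c := fun i => if odd i then odd_pattern s else even_pattern s) :
  0 < s -> p < n -> q < n -> (i, p) != (j, q) -> i <= j -> c i p = c j q ->
  c i p + 2 <= chain_dist n i p j q.
Proof.
rewrite /n /c /odd_pattern /even_pattern /chain_dist /cyc xpair_eqE => s0 pn qn.
by do ![case: ifP]; lia.
Qed.

Lemma four_colors (s i p j q : nat) (n := 4 * s + 2)
    (c := fun i => if i == 0 then first_pattern else even_pattern s) :
  0 < s -> i < 2 -> j < 2 -> p < n -> q < n -> (i, p) != (j, q) -> i <= j ->
  c i p = c j q -> c i p + 2 <= chain_dist n i p j q.
Proof.
rewrite /n /c /first_pattern /even_pattern /chain_dist /cyc xpair_eqE => s0 i2 j2 pn qn.
by do ![case: ifP]; lia.
Qed.

Section ThreeColorSequence.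

Variable f : nat -> nat.
Hypotheses (f_lt3 : forall j, f j < 3) (f_dist1 : forall j, f j <> f j.+1).
Hypotheses (f_dist2 : forall j, f j = f j.+2 -> f j = 0).
Hypotheses (f_dist3 : forall j, f j = f j.+3 -> f j <= 1).

(* Adjacent values 1, 2 cannot be extended by two terms on the side of the 1. *)
Lemma color0_alternates j : (f j.+2 == 0) = (f j.+3 != 0).
Proof.
have no12 k : f k.+2 = 1 -> f k.+3 = 2 -> False.
  move: (f_lt3 k) (f_lt3 k.+1) (@f_dist1 k) (@f_dist1 k.+1).
  by move: (@f_dist2 k) (@f_dist2 k.+1) (@f_dist3 k); lia.
have no21 k : f k = 2 -> f k.+1 = 1 -> False.
  move: (f_lt3 k.+2) (f_lt3 k.+3) (@f_dist1 k.+1) (@f_dist1 k.+2).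
  by move: (@f_dist2 k) (@f_dist2 k.+1) (@f_dist3 k); lia.
move: (no12 j) (no21 j.+2) (f_lt3 j.+2) (f_lt3 j.+3) (@f_dist1 j.+2).
by clear; lia.
Qed.

Lemma color_step2 j : f j.+2 != 0 -> f j.+4 != 0 /\ f j.+4 != f j.+2.
Proof.
move: (color0_alternates j) (color0_alternates j.+1) (@f_dist2 j.+2).
by clear; lia.
Qed.

Lemma color_period4 j m : f j.+2 != 0 -> f (j + 4 * m).+2 = f j.+2.
Proof.
move=> f0; elim: m => [|m IH]; first by rewrite muln0 addn0.
have -> : j + 4 * m.+1 = (j + 4 * m).+4 by lia.
have f1 : f (j + 4 * m).+2 != 0 by rewrite IH.
have [f2 n2] := color_step2 f1; have [f3 n3] := color_step2 f2.
move: (f_lt3 (j + 4 * m).+2) (f_lt3 (j + 4 * m).+4) (f_lt3 (j + 4 * m).+4.+2).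
by rewrite -IH; move: f1 f2 n2 f3 n3; clear; lia.
Qed.

Lemma color_not_periodic (s : nat) : ~ (forall j, f (j + (4 * s + 2)) = f j).
Proof.
move=> per.
have f0 j : f j.+2 = 0.
  apply/eqP; apply: contraT => f0; have f1 := color_period4 s f0.
  have := @color_step2 (j + 4 * s); rewrite f1 => /(_ f0)[_].
  have -> : (j + 4 * s).+4 = j.+2 + (4 * s + 2) by lia.
  by rewrite per eqxx.
by have := color0_alternates 0; rewrite !f0.
Qed.

End ThreeColorSequence.

Lemma packing_coloring_walk (T : finType) (e : rel T) (w : nat -> T) (k : nat)
  (c : {ffun T -> 'I_k}) (j d : nat) :
  packing_coloring e c -> (forall j, e (w j) (w j.+1)) -> w j != w (j + d) ->
  c (w j) = c (w (j + d)) :> nat -> c (w j) + 2 <= d.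
Proof.
move=> /forallP/(_ (w j))/forallP/(_ (w (j + d))) + w_edge nw cw.
have [uv dw] := dist_iter_le j d w_edge.
rewrite nw uv -val_eqE /= cw eqxx /= => /leq_trans/(_ dw).
by rewrite addSnnS.
Qed.

Lemma product_not_three_colorable (t s k : nat)
  (a : 'I_((2 * t) %/ 2) -> 2.-tuple 'I_(4 * s + 2)) :
  0 < t -> 0 < s -> k <= 3 ->
  ~~ packing_colorable (path_aligned_product (@cycle_graph (4 * s + 2)) a) k.
Proof.
move=> t0 s0 k3; apply/negP => /existsP[c c_packing].
have t0' : 0 < (2 * t) %/ 2 by rewrite mulKn.
have n0 : 0 < 4 * s + 2 by lia.
pose w j := (Ordinal t0', Ordinal (ltn_pmod j n0)).
have w_edge j : path_aligned_product (@cycle_graph (4 * s + 2)) a (w j) (w j.+1).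
  apply/or3P/Or31/andP; split=> //; apply/orP; left.
  by rewrite -val_eqE /= -(addn1 (j %% _)) modnDml addn1.
have w_neq j d : 0 < d <= 3 -> w j != w (j + d).
  move=> d3; apply/negP; rewrite xpair_eqE eqxx /= -val_eqE /= -{1}[j]addn0 eqn_modDl.
  by rewrite !modn_small //; lia.
pose f j : nat := c (w j).
have fd j d : 0 < d <= 3 -> f j = f (j + d) -> f j + 2 <= d.
  by move=> d3; exact: (packing_coloring_walk c_packing w_edge (w_neq j d d3)).
apply: (@color_not_periodic f _ _ _ _ s) => j.
- exact: leq_trans (ltn_ord _) k3.
- by rewrite -addn1 => /fd-/(_ isT); rewrite addn2.
- by rewrite -addn2 => /fd-/(_ isT); clear; lia.
- by rewrite -addn3 => /fd-/(_ isT); clear; lia.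
- by congr (nat_of_ord (c (_, _))); apply: val_inj; rewrite /= modnDr.
Qed.

Theorem theorem7 (t s : nat) (ht : 1 <= t) (hs : 1 <= s)
  (a : 'I_((2 * t) %/ 2) -> 2.-tuple 'I_(4 * s + 2))
  (ha : forall i, is_path_in (@cycle_graph (4 * s + 2)) (a i)) :
  [/\ 1 <= t <= 2 ->
        packing_chromatic (path_aligned_product (@cycle_graph (4 * s + 2)) a) <= 4,
      3 <= t ->
        packing_chromatic (path_aligned_product (@cycle_graph (4 * s + 2)) a) <= 5
    & t = 1 \/ t = 2 ->
        packing_chromatic (path_aligned_product (@cycle_graph (4 * s + 2)) a) = 4].
Proof.
have n2 : 2 < 4 * s + 2 by lia.
have le4 : 1 <= t <= 2 ->
    packing_chromatic (path_aligned_product (@cycle_graph (4 * s + 2)) a) <= 4.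
  case/andP=> _ t2; apply: packing_chromatic_le.
  apply: (chain_colorable n2 ha
    (c := fun i => if i == 0 then first_pattern else even_pattern s)).
    by move=> i p; rewrite /first_pattern /even_pattern; do ![case: ifP].
  rewrite mulKn // => i p j q it jt; apply: four_colors => //; exact: leq_trans t2.
split=> // [_|t12].
  apply: packing_chromatic_le; apply: (chain_colorable n2 ha
    (c := fun i => if odd i then odd_pattern s else even_pattern s)).
    by move=> i p; rewrite /odd_pattern /even_pattern; do ![case: ifP].
  by move=> i p j q _ _; apply: five_colors.
apply/eqP; rewrite eqn_leq le4; last by case: t12 => ->.
rewrite ltnNge; apply/negP => k3.
by have := product_not_three_colorable a ht hs k3; rewrite packing_chromatic_colorable.
Qed.
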